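(* Let $d\ge1$, $\mu\ge0$, let $P_0$ be the uniform measure on $[0,1]^d$, and let $A\subseteq[0,1]^d$ be measurable with $p=P_0(A)$. If $p>0$, then restricting the Poisson process $\mathrm{PPM}(\mu,d)$ to $A$ yields a Poisson process with mean count $\mu p$ and conditional location law $P_0(\,\cdot\mid A)$; precisely, in the ordered-list representation, $$(\mathrm{restrict}_A)_*\,\mathrm{PPM}(\mu,d)=\mathrm{PPM}_{\mathrm{on}}\bigl(\mu p,\;P_0(\,\cdot\mid A)\bigr).$$ If $p=0$, then the restricted process is empty almost surely.
   Context: $\mathrm{PointList}(d)=\coprod_{n\ge0}([0,1]^d)^n$ is the space of finite ordered lists of points of $[0,1]^d$, with the disjoint-union $\sigma$-algebra; $\iota_n:([0,1]^d)^n\to\mathrm{PointList}(d)$ is the inclusion. For $\lambda\ge0$ and a probability measure $Q$ on $[0,1]^d$, $\mathrm{PPM}_{\mathrm{on}}(\lambda,Q)=\sum_{n\ge0}e^{-\lambda}\frac{\lambda^n}{n!}\,(\iota_n)_*Q^{\otimes n}$, a probability measure on $\mathrm{PointList}(d)$; and $\mathrm{PPM}(\mu,d)=\mathrm{PPM}_{\mathrm{on}}(\mu,P_0)$. The map $\mathrm{restrict}_A:\mathrm{PointList}(d)\to\mathrm{PointList}(d)$ deletes from a list all entries not in $A$, keeping the remaining entries in their original order (reindexed). $P_0(B\mid A)=P_0(B\cap A)/P_0(A)$. *)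

(* Defs.v *)
From HB Require Import structures.
From mathcomp Require Import all_boot all_order all_algebra.
From mathcomp Require Import all_classical all_reals all_analysis.

Set Implicit Arguments.
Unset Strict Implicit.
Unset Printing Implicit Defensive.

Import Order.TTheory GRing.Theory Num.Theory.
Import numFieldNormedType.Exports.

Local Open Scope classical_set_scope.
Local Open Scope ring_scope.

Section power_probability.
Context d (T : measurableType d) (R : realType).

Definition cons_pair n (xt : T * n.-tuple T) : n.+1.-tuple T :=
  [tuple of xt.1 :: xt.2].

Lemma measurable_cons_pair n :
  measurable_fun [set: T * n.-tuple T] (@cons_pair n).
Proof. exact: measurable_cons. Qed.

HB.instance Definition _ n :=
  isMeasurableFun.Build _ _ _ _ (@cons_pair n) (measurable_cons_pair (n := n)).

(* The library has no n-fold product measure: it is built by transporting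
   Q \x Q^n along T * n.-tuple T -> n.+1.-tuple T. Its characteristic value on
   boxes is power_prob_box. *)
Fixpoint power_prob (Q : probability T R) (n : nat) :
    probability (n.-tuple T) R :=
  if n is m.+1 then
    distribution (Q \x power_prob Q m)%E (@cons_pair m)
  else \d_([tuple] : 0.-tuple T).

Lemma power_prob_box (Q : probability T R) n (B : 'I_n -> set T) :
  (forall i, measurable (B i)) ->
  power_prob Q n [set x | forall i, B i (tnth x i)] = (\prod_(i < n) Q (B i))%E.
Proof.
elim: n B => [|n IHn] B mB.
  by rewrite big_ord0 /= diracE mem_set// => -[].
rewrite big_ord_recl -IHn//=.
rewrite /distribution /pushforward -product_measure1E//; last first.
  rewrite (_ : mkset _ = \bigcap_(i in [set: 'I_n])
      ((@tnth n T)^~ i @^-1` B (lift ord0 i))); last first.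
    by apply/seteqP; split=> x /= h i; [move=> _|]; exact: h.
  apply: fin_bigcap_measurable => // i _.
  by rewrite -[X in measurable X]setTI; exact: measurable_tnth.
congr (product_measure1 _ _ _); apply/seteqP; split=> -[x t] /=.
  move=> h; split; first exact: (h ord0).
  by move=> i; have := h (lift ord0 i); rewrite tnthS.
move=> [h0 h] i; have [j ->|->] := unliftP ord0 i; last exact: h0.
by rewrite tnthS; exact: h.
Qed.

End power_probability.

Definition point_list (T : Type) : Type := {n : nat & n.-tuple T}.

Definition list_inj (T : Type) (n : nat) (x : n.-tuple T) : point_list T :=
  existT _ n x.

Definition empty_list {T : Type} : point_list T := list_inj [tuple].

HB.instance Definition _ (T : choiceType) := Choice.on (point_list T).
HB.instance Definition _ (T : choiceType) :=
  isPointed.Build (point_list T) empty_list.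

Definition point_list_display : measure_display -> measure_display.
Proof. exact. Qed.

Section point_list_measurable.
Context d (T : measurableType d).

Definition point_list_measurable : set (set (point_list T)) :=
  [set U | forall n, measurable (@list_inj T n @^-1` U)].

Let point_list_measurable0 : point_list_measurable set0.
Proof. by move=> n; rewrite preimage_set0. Qed.

Let point_list_measurableC U :
  point_list_measurable U -> point_list_measurable (~` U).
Proof. by move=> mU n; rewrite preimage_setC; exact: measurableC (mU n). Qed.

Let point_list_measurable_bigcup (F : (set (point_list T))^nat) :
  (forall i, point_list_measurable (F i)) ->
  point_list_measurable (\bigcup_i F i).
Proof.
move=> mF n; rewrite preimage_bigcup; apply: bigcupT_measurable => i.
exact: mF.
Qed.

HB.instance Definition _ := @isMeasurable.Build (point_list_display d)
  (point_list T) point_list_measurable point_list_measurable0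
  point_list_measurableC point_list_measurable_bigcup.

Lemma measurable_list_inj n : measurable_fun [set: n.-tuple T] (@list_inj T n).
Proof. by move=> _ U mU; rewrite setTI; exact: mU. Qed.

HB.instance Definition _ n := isMeasurableFun.Build _ _ _ _ (@list_inj T n)
  (measurable_list_inj (n := n)).

End point_list_measurable.

Definition restrict_list (T : Type) (A : set T) (s : point_list T) :
    point_list T :=
  list_inj (in_tuple [seq x <- projT2 s | x \in A]).

Section measurable_restrict_list.
Context d (T : measurableType d).

Lemma list_inj_eq n m (x : n.-tuple T) (y : m.-tuple T) :
  tval x = tval y -> list_inj x = list_inj y.
Proof.
move=> xy; have nm : n = m by rewrite -(size_tuple x) -(size_tuple y) xy.
by subst m; congr list_inj; exact: val_inj.
Qed.

Lemma measurable_restrict_list (A : set T) : measurable A ->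
  measurable_fun [set: point_list T] (restrict_list A).
Proof.
move=> mA _ U mU; rewrite setTI.
have mUn n : measurable (@list_inj T n @^-1` U) := mU n.
suff mRU n :
  measurable (@list_inj T n @^-1` (restrict_list A @^-1` U)) by [].
pose sel (b : n.-tuple bool) := in_tuple (mask b (enum 'I_n)).
pose proj b (x : n.-tuple T) := [tuple tnth x (tnth (sel b) j) | j < _].
pose D (b : n.-tuple bool) := [set x : n.-tuple T |
  forall i, (tnth x i \in A) = tnth b i].
have projE b x : D b x ->
    restrict_list A (list_inj x) = list_inj (proj b x).
  move=> Dbx; apply: list_inj_eq => /=.
  rewrite -[in LHS](map_tnth_enum x) filter_map.
  rewrite [RHS](map_comp (tnth x) (tnth (sel b))) map_tnth_enum; congr map.
  rewrite filter_mask; congr mask.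
  by rewrite -[RHS](map_tnth_enum b); apply: eq_map => i /=; exact: Dbx.
rewrite (_ : _ @^-1` _ = \bigcup_(b in [set: n.-tuple bool])
    (D b `&` proj b @^-1` (@list_inj T _ @^-1` U))); last first.
  apply/seteqP; split=> [x Ux|x [b _ [Dbx]]].
    have Dx : D [tuple tnth x i \in A | i < n] x.
      by move=> i; rewrite tnth_mktuple.
    exists [tuple tnth x i \in A | i < n] => //; split => //.
    by move: Ux; rewrite /preimage/= (projE _ _ Dx).
  by rewrite /preimage/= (projE _ _ Dbx).
apply: fin_bigcup_measurable => // b _; apply: measurableI.
  rewrite (_ : D b = \bigcap_(i in [set: 'I_n])
     ((@tnth n T)^~ i @^-1` (if tnth b i then A else ~` A))); last first.
    apply/seteqP; split=> x /= h i.
      move=> _; have := h i; rewrite /preimage/=.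
      by case: (tnth b i) => [/set_mem|/negbT]; rewrite ?notin_setE.
    have := h i Logic.I; rewrite /preimage/=.
    by case: (tnth b i) => Ax; [exact: mem_set|exact: memNset].
  apply: fin_bigcap_measurable => // i _.
  rewrite -[X in measurable X]setTI; apply: measurable_tnth => //.
  by case: ifPn => // _; exact: measurableC.
rewrite -[X in measurable X]setTI.
have : measurable_fun [set: n.-tuple T] (proj b).
  apply/measurable_fun_tnthP => j.
  rewrite (_ : _ \o _ = fun x : n.-tuple T => tnth x (tnth (sel b) j)).
    exact: measurable_tnth.
  by apply/funext => x /=; rewrite tnth_mktuple.
by apply => //; exact: mUn.
Qed.

End measurable_restrict_list.

Section poisson_process.
Context d (T : measurableType d) (R : realType).

Definition poisson_weight (l : {nonneg R}) (n : nat) : {nonneg R} :=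
  (expR (- l%:num) * (l%:num ^+ n / n`!%:R))%:nng.

Definition ppm_on (l : {nonneg R}) (Q : probability T R) :
    set (point_list T) -> \bar R :=
  mseries (fun n => mscale (poisson_weight l n)
                      (distribution (power_prob Q n) (@list_inj T n))) 0.

HB.instance Definition _ l Q := Measure.on (ppm_on l Q).

Let ppm_on_setT l Q : ppm_on l Q [set: point_list T] = 1%E.
Proof.
rewrite /ppm_on /mseries.
have wE n : mscale (poisson_weight l n)
    (distribution (power_prob Q n) (@list_inj T n)) [set: point_list T] =
    ((expR (- l%:num))%:E * (l%:num ^+ n / n`!%:R)%:E)%E.
  rewrite /mscale/= /distribution /pushforward preimage_setT.
  by rewrite probability_setT mule1 -EFinM.
transitivity (\sum_(0 <= n <oo)
    ((expR (- l%:num))%:E * (l%:num ^+ n / n`!%:R)%:E))%E.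
  by apply: eq_eseriesr => n _; exact: wE.
rewrite nneseriesZl//.
rewrite [RHS](_ : _ = (expR (- l%:num))%:E * (expR l%:num)%:E)%E; last first.
  by rewrite -EFinM expRN mulVf ?gt_eqF ?expR_gt0.
congr *%E; rewrite expRE -EFin_lim; last first.
  rewrite /pseries/=; under eq_fun do rewrite mulrC.
  exact: is_cvg_series_exp_coeff.
apply/congr_lim/funext => n/=; rewrite /pseries/= /series/= -sumEFin//.
by under eq_bigr do rewrite mulrC.
Qed.

HB.instance Definition _ l Q :=
  Measure_isProbability.Build _ _ _ (ppm_on l Q) (@ppm_on_setT l Q).

End poisson_process.

Definition nng_prob d (T : measurableType d) (R : realType)
    (P : probability T R) (A : set T) : {nonneg R} :=
  NngNum (fine_ge0 (measure_ge0 P A)).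

Section conditional_probability.
Context d (T : measurableType d) (R : realType).
Variables (P : probability T R) (A : set T).
Hypotheses (mA : measurable A) (A_gt0 : (0 < P A)%E).

(* The proofs that A is measurable and non-null are arguments so that the
   quotient carries a canonical probability structure. *)
Definition cond_prob of measurable A & (0 < P A)%E : set T -> \bar R :=
  fun B => (fine (P (B `&` A)) / fine (P A))%:E.

Local Notation condP := (cond_prob mA A_gt0).

Let PA_fin : P A \is a fin_num. Proof. exact: fin_num_measure. Qed.

Let PA_gt0 : 0 < fine (P A).
Proof. by rewrite fine_gt0// A_gt0/= ltey_eq PA_fin. Qed.

Let cond_prob0 : condP set0 = 0%E.
Proof. by rewrite /cond_prob set0I measure0 mul0r. Qed.

Let cond_prob_ge0 B : (0 <= condP B)%E.
Proof. by rewrite lee_fin divr_ge0// fine_ge0. Qed.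

Let cond_prob_sigma_additive : semi_sigma_additive condP.
Proof.
have inv_ge0 : 0 <= (fine (P A))^-1 by rewrite invr_ge0 ltW.
pose nu := mscale (NngNum inv_ge0) (mrestr P mA).
have condE B : measurable B -> condP B = nu B.
  move=> mB; rewrite /cond_prob /nu /mscale/= /mrestr mulrC EFinM fineK//.
  by rewrite fin_num_measure//; exact: measurableI.
move=> F mF tF mUF; rewrite condE//.
under eq_fun do under eq_bigr do rewrite condE//.
exact: measure_semi_sigma_additive.
Qed.

HB.instance Definition _ := isMeasure.Build _ _ _ condP
  cond_prob0 cond_prob_ge0 cond_prob_sigma_additive.

Let cond_prob_setT : condP [set: T] = 1%E.
Proof. by rewrite /cond_prob setTI divff// gt_eqF. Qed.

HB.instance Definition _ :=
  Measure_isProbability.Build _ _ _ condP cond_prob_setT.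

End conditional_probability.

Section unit_interval.
Context (R : realType).

Definition unit_interval : Type := {x : R | x \in `[0%R, 1%R]}.

HB.instance Definition _ := SubType.on unit_interval.
HB.instance Definition _ := Choice.on unit_interval.

Let zero_in01 : (0 : R) \in `[0%R, 1%R].
Proof. by rewrite in_itv/= lexx ler01. Qed.

HB.instance Definition _ :=
  isPointed.Build unit_interval (exist _ (0 : R) zero_in01).

Definition unit_interval_val (x : unit_interval) : R := val x.

Definition unit_interval_display : measure_display.
Proof. exact: default_measure_display. Qed.

Definition unit_interval_measurable : set (set unit_interval) :=
  preimage_set_system [set: unit_interval] unit_interval_val
    (@measurable _ (measurableTypeR R)).

Let sigma_algebra_unit_interval :
  sigma_algebra [set: unit_interval] unit_interval_measurable.
Proof. exact/sigma_algebra_preimage/sigma_algebra_measurable. Qed.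

Let unit_interval_measurable0 : unit_interval_measurable set0.
Proof. by case: sigma_algebra_unit_interval. Qed.

Let unit_interval_measurableC U :
  unit_interval_measurable U -> unit_interval_measurable (~` U).
Proof.
by case: sigma_algebra_unit_interval => _ + _ mU => /(_ U mU); rewrite setTD.
Qed.

Let unit_interval_measurable_bigcup (F : (set unit_interval)^nat) :
  (forall i, unit_interval_measurable (F i)) ->
  unit_interval_measurable (\bigcup_i F i).
Proof. by case: sigma_algebra_unit_interval => _ _; exact. Qed.

HB.instance Definition _ := @isMeasurable.Build unit_interval_display
  unit_interval unit_interval_measurable unit_interval_measurable0
  unit_interval_measurableC unit_interval_measurable_bigcup.

Lemma image_unit_interval_val (U : set unit_interval) (B : set R) :
  unit_interval_val @^-1` B = U -> unit_interval_val @` U = B `&` `[0, 1].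
Proof.
move=> <-; apply/seteqP; split=> [_ [x Bx <-]|x [Bx x01]].
  by split=> //; exact: (valP x).
by exists (exist _ x x01).
Qed.

Lemma measurable_image_unit_interval_val (U : set unit_interval) :
  measurable U -> @measurable _ (measurableTypeR R) (unit_interval_val @` U).
Proof.
move=> [B mB]; rewrite setTI => /image_unit_interval_val ->.
exact: measurableI.
Qed.

Definition uniform01 (U : set unit_interval) : \bar R :=
  lebesgue_measure (unit_interval_val @` U).

Let uniform01_0 : uniform01 set0 = 0%E.
Proof. by rewrite /uniform01 image_set0 measure0. Qed.

Let uniform01_ge0 U : (0 <= uniform01 U)%E.
Proof. exact: measure_ge0. Qed.

Let uniform01_sigma_additive : semi_sigma_additive uniform01.
Proof.
move=> F mF tF mUF; rewrite /uniform01 image_bigcup.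
apply: measure_semi_sigma_additive.
- by move=> i; exact: measurable_image_unit_interval_val.
- apply/trivIsetP => i j _ _ ij; apply/seteqP; split=> // _ [[x Fx <-] [y Fy]].
  move=> /val_inj yx; move/trivIsetP : tF => /(_ _ _ Logic.I Logic.I ij).
  by move/seteqP => -[/(_ x) + _]; apply; split=> //; rewrite -yx.
- by rewrite -image_bigcup; exact: measurable_image_unit_interval_val.
Qed.

HB.instance Definition _ := isMeasure.Build _ _ _ uniform01
  uniform01_0 uniform01_ge0 uniform01_sigma_additive.

Let uniform01_setT : uniform01 [set: unit_interval] = 1%E.
Proof.
rewrite /uniform01 (@image_unit_interval_val _ [set: R])// setTI.
by rewrite lebesgue_measure_itv/= lte_fin ltr01 oppr0 adde0.
Qed.

HB.instance Definition _ :=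
  Measure_isProbability.Build _ _ _ uniform01 uniform01_setT.

End unit_interval.
Arguments uniform01 : clear implicits.

Notation cube R d := (d.-tuple (unit_interval R)).

(* Lebesgue measure on [0,1]^d: the library only provides it in dimension one,
   hence the d-fold power. *)
Definition uniform_cube (R : realType) (d : nat) : probability (cube R d) R :=
  power_prob (uniform01 R) d.

Definition ppm (R : realType) (mu : {nonneg R}) (d : nat) :
    probability (point_list (cube R d)) R :=
  ppm_on mu (uniform_cube R d).

(* Main.v *)
(* Independent thinning. Splitting on whether each of the n points falls in A,
   Pascal's rule shows by induction on n that the restriction to A of n i.i.d.
   points of law P is the binomial mixture, over k ~ Bin(n, p) with p = P(A), of
   k i.i.d. points of law P(. | A). Mixing over n ~ Poisson(mu) turns the series
   into the Cauchy product of the Poisson(mu p) mixture by e^{-mu} times the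
   exponential series at mu (1 - p), whose sum e^{-mu p} is the missing
   normalisation. *)
Require Import Defs.
From HB Require Import structures.
From mathcomp Require Import all_boot all_order all_algebra.
From mathcomp Require Import all_classical all_reals all_analysis.
From mathcomp Require Import measurable_realfun ring.

Set Implicit Arguments.
Unset Strict Implicit.
Unset Printing Implicit Defensive.

Import Order.TTheory GRing.Theory Num.Theory.
Import numFieldNormedType.Exports.

Local Open Scope classical_set_scope.
Local Open Scope ring_scope.

(** * Integration against restricted and conditional measures *)

Lemma integral_mrestr d (T : measurableType d) (R : realType)
    (mu : {measure set T -> \bar R}) (D : set T) (mD : measurable D)
    (f : T -> \bar R) :
  measurable_fun [set: T] f -> (forall x, 0 <= f x)%E ->
  (\int[mrestr mu mD]_x f x = \int[mu]_(x in D) f x)%E.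
Proof.
move=> mf f0.
rewrite [LHS](ge0_negligible_integral (measurableC mD))//; last first.
  by rewrite /= /mrestr setICl measure0.
rewrite setTD setCK; apply: eq_measure_integral => B mB BD.
by rewrite /= /mrestr setIidl.
Qed.

Section conditional_integral.
Context d (T : measurableType d) (R : realType).
Variables (P : probability T R) (A : set T).
Hypotheses (mA : measurable A) (A_gt0 : (0 < P A)%E).

(** On measurable sets, [P A] times the conditional law is the restriction of [P] to [A]. This is
    how the conditional law enters the induction on the number of points. *)
Lemma integral_cond_prob (f : T -> \bar R) :
  measurable_fun [set: T] f -> (forall x, 0 <= f x)%E ->
  (\int[P]_(x in A) f x = P A * \int[cond_prob mA A_gt0]_x f x)%E.
Proof.
move=> mf f0; have PA_fin : P A \is a fin_num by exact: fin_num_measure.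
have PA_neq0 : fine (P A) != 0 by rewrite fine_eq0// gt_eqF.
rewrite -{1}(fineK PA_fin).
rewrite -[fine _]/((nng_prob P A)%:num) -ge0_integral_mscale//.
rewrite -integral_mrestr//; apply: eq_measure_integral => B mB _.
rewrite /= /mrestr /mscale/= /cond_prob -EFinM mulrC divfK// fineK//.
by rewrite fin_num_measure//; exact: measurableI.
Qed.

End conditional_integral.

(** * Prepending a point and slicing the power measure *)

Definition cons_list (T : Type) (a : T) (s : point_list T) : point_list T :=
  list_inj [tuple of a :: projT2 s].

Lemma restrict_list_cons (T : Type) (A : set T) n (a : T) (x : n.-tuple T) :
  restrict_list A (list_inj [tuple of a :: x]) =
  if a \in A then cons_list a (restrict_list A (list_inj x))
  else restrict_list A (list_inj x).
Proof.
rewrite /restrict_list /=; case: (a \in A) => //.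
by congr list_inj; exact: val_inj.
Qed.

Section power_sections.
Context d (T : measurableType d) (R : realType).
Implicit Types (Q : probability T R) (U : set (point_list T)).

(** Seen as a section of a subset of the product, the set inherits measurability, both in itself and
    of its mass as a function of [a]. *)
Lemma list_inj_cons U n (a : T) :
  @list_inj T n @^-1` (cons_list a @^-1` U) =
  xsection (@cons_pair _ T n @^-1` (@list_inj T n.+1 @^-1` U)) a.
Proof.
by apply/seteqP; split => x; rewrite xsectionE.
Qed.

Lemma measurable_cons_list (a : T) U : measurable U ->
  measurable (cons_list a @^-1` U).
Proof.
move=> mU.
suff mn n : measurable (@list_inj T n @^-1` (cons_list a @^-1` U)) by [].
rewrite list_inj_cons; apply: measurable_xsection.
rewrite -[X in measurable X]setTI.
by apply: measurable_cons_pair => //; exact: mU.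
Qed.

Lemma measurable_power_prob_cons Q n U : measurable U ->
  measurable_fun [set: T]
    (fun a => power_prob Q n (@list_inj T n @^-1` (cons_list a @^-1` U))).
Proof.
move=> mU; under eq_fun do rewrite list_inj_cons.
apply: measurable_fun_xsection.
rewrite -[X in measurable X]setTI.
by apply: measurable_cons_pair => //; exact: mU.
Qed.

(** Conditioning on the first point: a product measure integrates the masses of sections. *)
Lemma power_probS Q n U :
  power_prob Q n.+1 (@list_inj T n.+1 @^-1` U) =
  (\int[Q]_a power_prob Q n (@list_inj T n @^-1` (cons_list a @^-1` U)))%E.
Proof. by under [RHS]eq_integral do rewrite list_inj_cons. Qed.

End power_sections.

(** * Binomial weights *)

Definition binomial_weight (R : realType) (p q : R) (n k : nat) : R :=
  'C(n, k)%:R * (p ^+ k * q ^+ (n - k)).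

Lemma binomial_weight_ge0 (R : realType) (p q : R) n k :
  0 <= p -> 0 <= q -> 0 <= binomial_weight p q n k.
Proof. by move=> p0 q0; rewrite !mulr_ge0 ?exprn_ge0. Qed.

Lemma sum_binomial_weightS (R : realType) (p q : R) (m : nat -> R) n :
  \sum_(k < n.+2) binomial_weight p q n.+1 k * m k =
  p * (\sum_(k < n.+1) binomial_weight p q n k * m k.+1) +
  q * (\sum_(k < n.+1) binomial_weight p q n k * m k).
Proof.
(* The added term [k = n.+1] vanishes since ['C(n, n.+1) = 0]; both sides then have the same range,
   and Pascal's rule applies termwise for [k > 0]. *)
have -> : q * (\sum_(k < n.+1) binomial_weight p q n k * m k) =
    \sum_(k < n.+2) 'C(n, k)%:R * (p ^+ k * q ^+ (n.+1 - k)) * m k.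
  rewrite [RHS]big_ord_recr/= bin_small// mul0r mul0r addr0 mulr_sumr.
  apply: eq_bigr => k _; rewrite subSn ?leq_ord// exprS /binomial_weight.
  by ring.
rewrite [RHS]addrC big_ord_recl [in RHS]big_ord_recl /binomial_weight !bin0.
rewrite -addrA; congr +%R; rewrite mulr_sumr -big_split/=.
apply: eq_bigr => k _.
by rewrite /bump/= add1n binS natrD subSS exprS; ring.
Qed.

(** * Restriction of a fixed number of points *)

Section restriction.
Context d (T : measurableType d) (R : realType).
Variables (P : probability T R) (A : set T).
Hypotheses (mA : measurable A) (A_gt0 : (0 < P A)%E).
Let p : R := fine (P A).
Let q : R := 1 - p.
Let condP := cond_prob mA A_gt0.

Let pE : P A = p%:E.
Proof. by rewrite fineK// fin_num_measure. Qed.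

Let p_ge0 : 0 <= p. Proof. exact: fine_ge0. Qed.

Let q_ge0 : 0 <= q.
Proof. by rewrite subr_ge0 -lee_fin -pE probability_le1. Qed.

Let qE : P (~` A) = q%:E.
Proof. by rewrite probability_setC// pE. Qed.

Lemma power_prob_restrict n U : measurable U ->
  (power_prob P n (@list_inj T n @^-1` (restrict_list A @^-1` U)) =
   \sum_(k < n.+1) (binomial_weight p q n k)%:E *
     power_prob condP k (@list_inj T k @^-1` U))%E.
Proof.
(* [U] stays general: the induction hypothesis is needed at [U] and at its preimage under
   [cons_list a]. *)
elim: n U => [|n IHn] U mU.
  rewrite big_ord1 /binomial_weight/= bin0 !mul1r mul1e /preimage/=.
  congr (\d_ _ _); apply/seteqP; split=> x /=;
    by rewrite (tuple0 x)/= (_ : restrict_list A _ = list_inj [tuple])//;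
    congr list_inj; exact: val_inj.
pose m k : R := fine (power_prob condP k (@list_inj T k @^-1` U)).
have mE k : power_prob condP k (@list_inj T k @^-1` U) = (m k)%:E.
  by rewrite fineK// fin_num_measure//; exact: mU.
have mRU : measurable (restrict_list A @^-1` U).
  by rewrite -[X in measurable X]setTI; exact: measurable_restrict_list.
rewrite power_probS -[in LHS](setUv A) ge0_integral_setU//; last 3 first.
- exact: measurableC.
- by rewrite setUv; exact: measurable_power_prob_cons.
- by apply/disj_setPCl.
(* A first point in [A] survives and is prepended to the restricted tail; one outside is deleted, so
   the second integrand is constant in [a]. *)
transitivity ((\int[P]_(a in A) (\sum_(k < n.+1) (binomial_weight p q n k)%:E *
     power_prob condP k (@list_inj T k @^-1` (cons_list a @^-1` U)))) +
   (\int[P]_(a in ~` A) (\sum_(k < n.+1) (binomial_weight p q n k)%:E *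
     power_prob condP k (@list_inj T k @^-1` U))))%E.
  congr +%E; apply: eq_integral => a Aa.
    rewrite -IHn; last exact: measurable_cons_list.
    congr (power_prob _ _ _); apply/seteqP; split=> x /=;
    by rewrite /preimage/= restrict_list_cons Aa.
  rewrite -IHn//; congr (power_prob _ _ _); apply/seteqP; split=> x /=;
  rewrite /preimage/= restrict_list_cons ifN//;
  by move: Aa; rewrite in_setC.
rewrite integral_cst//; last exact: measurableC.
rewrite integral_cond_prob; last 2 first.
- apply: emeasurable_sum => k; apply: measurable_funeM.
  exact: measurable_power_prob_cons.
- move=> a; apply: sume_ge0 => k _; rewrite mule_ge0// lee_fin.
  exact: binomial_weight_ge0.
rewrite ge0_integral_sum//; last 2 first.
- by move=> k; apply: measurable_funeM; exact: measurable_power_prob_cons.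
- by move=> k a _; rewrite mule_ge0// lee_fin binomial_weight_ge0.
(* Integrating the prepended point against [condP] turns [k] conditional points into [k.+1], the
   shifted sum of [sum_binomial_weightS]. *)
under [in LHS]eq_bigr => k _.
  rewrite ge0_integralZl_EFin//; last 2 first.
  - exact: measurable_power_prob_cons.
  - exact: binomial_weight_ge0.
  rewrite -power_probS mE -EFinM.
  over.
under [X in (_ + X * _)%E]eq_bigr do rewrite mE -EFinM.
under [RHS]eq_bigr do rewrite mE -EFinM.
rewrite !sumEFin -/p pE.
rewrite [X in (_ + _ * X)%E]qE -!EFinM -EFinD sum_binomial_weightS.
by rewrite [X in _ + X]mulrC.
Qed.

End restriction.

(** * Cauchy product and exponential series *)

Lemma nneseries_cauchy_product (R : realType) (a b : nat -> R) :
  (forall k, 0 <= a k) -> (forall k, 0 <= b k) ->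
  (\sum_(n <oo) (\sum_(k < n.+1) a k * b (n - k)%N)%:E =
   \sum_(k <oo) (a k)%:E * \sum_(j <oo) (b j)%:E)%E.
Proof.
move=> a0 b0.
(* Extension by zero above the diagonal makes the triangular sum a double series of nonnegative
   terms, whose order can be exchanged. *)
pose u n k : \bar R := if (k <= n)%N then (a k * b (n - k)%N)%:E else 0%E.
have u0 n k : (0 <= u n k)%E.
  by rewrite /u; case: ifP; rewrite // lee_fin mulr_ge0.
transitivity (\sum_(n <oo) \sum_(k <oo) u n k)%E.
  apply: eq_eseriesr => n _.
  rewrite (nneseries_split 0 n.+1)// add0n [X in (_ + X)%E]eseries0 ?adde0.
    rewrite big_mkord -sumEFin; apply: eq_bigr => k _.
    by rewrite /u leq_ord.
  by move=> k nk _; rewrite /u leqNgt nk.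
rewrite nneseries_interchange//; apply: eq_eseriesr => k _.
(* For fixed [k] the terms [n < k] are zero; the rest is reindexed by [n = k + j]. *)
rewrite (nneseries_split 0 k)// add0n big1_seq ?add0e; last first.
  by move=> n /=; rewrite mem_index_iota => /andP[_ nk]; rewrite /u leqNgt nk.
rewrite -nneseries_addn// -nneseriesZl//; last first.
  by move=> j _; rewrite lee_fin.
by apply: eq_eseriesr => j _; rewrite /u leq_addl addnK EFinM.
Qed.

Lemma nneseries_expR (R : realType) (x : R) : 0 <= x ->
  (\sum_(n <oo) (x ^+ n / n`!%:R)%:E = (expR x)%:E)%E.
Proof.
move=> x0; rewrite expRE -EFin_lim; last first.
  rewrite /pseries/=; under eq_fun do rewrite mulrC.
  exact: is_cvg_series_exp_coeff.
apply/congr_lim/funext => n/=; rewrite /pseries/= /series/= -sumEFin//.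
by apply: eq_bigr => k _; rewrite mulrC.
Qed.

(** * Mixing over the Poisson number of points *)

Section poisson_restriction.
Context d (T : measurableType d) (R : realType).
Variables (P : probability T R) (A : set T) (mA : measurable A).

Lemma ppm_onE (l : {nonneg R}) (Q : probability T R) U :
  ppm_on l Q U = (\sum_(n <oo)
    (poisson_weight l n)%:num%:E * power_prob Q n (@list_inj T n @^-1` U))%E.
Proof. by []. Qed.

Lemma ppm_on_restrict (A_gt0 : (0 < P A)%E) (mu : {nonneg R}) U :
  measurable U ->
  ppm_on mu P (restrict_list A @^-1` U) =
  ppm_on (mu%:num * (nng_prob P A)%:num)%:nng (cond_prob mA A_gt0) U.
Proof.
move=> mU; rewrite !ppm_onE; set x := mu%:num.
pose p : R := fine (P A); pose q : R := 1 - p.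
have p0 : 0 <= p by exact: fine_ge0.
have q0 : 0 <= q.
  by rewrite subr_ge0 -lee_fin fineK ?probability_le1// fin_num_measure.
pose condP := cond_prob mA A_gt0.
pose m k : R := fine (power_prob condP k (@list_inj T k @^-1` U)).
have m0 k : 0 <= m k by exact: fine_ge0.
have mE k : power_prob condP k (@list_inj T k @^-1` U) = (m k)%:E.
  by rewrite fineK// fin_num_measure//; exact: mU.
pose a k := (x * p) ^+ k / k`!%:R * m k.
pose b j := expR (- x) * ((x * q) ^+ j / j`!%:R).
have x0 : 0 <= x by rewrite /x.
have a0 k : 0 <= a k by rewrite !mulr_ge0 ?exprn_ge0 ?mulr_ge0// invr_ge0.
have b0 k : 0 <= b k.
  by rewrite !mulr_ge0 ?expR_ge0 ?exprn_ge0 ?mulr_ge0// invr_ge0.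
transitivity (\sum_(n <oo) (\sum_(k < n.+1) a k * b (n - k)%N)%:E)%E.
  apply: eq_eseriesr => n _; rewrite power_prob_restrict//.
  under eq_bigr do rewrite mE -EFinM.
  rewrite sumEFin -EFinM; congr EFin; rewrite mulr_sumr.
  apply: eq_bigr => k _; rewrite /= /binomial_weight -/p -/q -/x /a /b.
  have kn : (k <= n)%N by rewrite leq_ord.
  have fact_neq0 i : i`!%:R != 0 :> R by rewrite pnatr_eq0 -lt0n fact_gt0.
  (* Writing [n!] as ['C(n, k) * (k! * (n - k)!)] cancels the binomial coefficient and separates [k]
     from [n - k]. *)
  rewrite -{1}(subnKC kn) -(bin_fact kn) exprD !exprMn !natrM; field.
  by rewrite !fact_neq0 pnatr_eq0 -lt0n bin_gt0 kn.
rewrite nneseries_cauchy_product//.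
have -> : (\sum_(j <oo) (b j)%:E = (expR (- (x * p)))%:E)%E.
  rewrite (_ : - (x * p) = - x + x * q); last by rewrite /q; ring.
  rewrite expRD EFinM -(@nneseries_expR _ (x * q)) ?mulr_ge0// -nneseriesZl//.
  by move=> j _; rewrite lee_fin divr_ge0 ?exprn_ge0 ?mulr_ge0.
apply: eq_eseriesr => k _; rewrite mE -!EFinM /a /=; congr EFin.
by rewrite -/p -/x; ring.
Qed.

(** For each [n], the box of tuples avoiding [A] has mass [(1 - P A) ^ n = 1], so every term of the
    Poisson mixture vanishes on the event that a point survives. *)
Lemma ppm_on_restrict_null (mu : {nonneg R}) : P A = 0%E ->
  {ae ppm_on mu P, forall s, restrict_list A s = empty_list}.
Proof.
move=> PA0.
have mN : measurable (~` [set empty_list] : set (point_list T)).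
  suff mn n : measurable (@list_inj T n @^-1` (~` [set empty_list])) by [].
  case: n => [|n]; rewrite /preimage/=.
    rewrite (_ : mkset _ = set0)//; apply/seteqP; split=> // x /=.
    by apply; rewrite (tuple0 x).
  by rewrite (_ : mkset _ = setT)//; apply/seteqP; split.
have mR : measurable (restrict_list A @^-1` (~` [set empty_list])).
  by rewrite -[X in measurable X]setTI;
    exact: (measurable_restrict_list mA measurableT mN).
exists (restrict_list A @^-1` (~` [set empty_list])); split=> //.
rewrite ppm_onE; apply: eseries0 => n _ _.
rewrite [X in (_ * X)%E](_ : _ = 0%E) ?mule0//.
have box1 : power_prob P n [set x | forall i, (~` A) (tnth x i)] = 1%E.
  rewrite (@power_prob_box _ _ _ P n (fun=> ~` A)) => [|i];
    last exact: measurableC.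
  by rewrite big1// => i _; rewrite probability_setC// PA0 sube0.
set B := [set x | _] in box1.
(* The restricted list is nonempty exactly when some entry lies in [A]. *)
rewrite (_ : _ @^-1` _ = ~` B); last first.
  apply/seteqP; split=> x; rewrite /preimage/=; apply: contra_not.
    move=> Bx; apply: list_inj_eq => /=; apply/eqP.
    rewrite -[_ == _]negbK -has_filter; apply/hasPn => _ /tnthP[i ->].
    by apply/negP; rewrite inE; exact: Bx.
  move=> /(congr1 (fun s : point_list T => tval (projT2 s))) /= xA i Ai.
  have : tnth x i \in [seq y <- x | y \in A].
    by rewrite mem_filter mem_tnth andbT inE.
  by rewrite xA.
have mB : measurable B.
  rewrite (_ : B = \bigcap_(i in [set: 'I_n]) ((@tnth n T)^~ i @^-1` ~` A)).
    apply: fin_bigcap_measurable => // i _; rewrite -[X in measurable X]setTI.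
    by apply: measurable_tnth => //; exact: measurableC.
  by apply/seteqP; split=> x h i; [move=> _|]; exact: h.
by rewrite probability_setC// box1 subee.
Qed.

End poisson_restriction.

Theorem theorem3p14 (R : realType) (d : nat) (mu : {nonneg R})
    (A : set (cube R d)) (d_ge1 : (1 <= d)%N) (mA : measurable A) :
  (forall p_gt0 : (0 < uniform_cube R d A)%E,
    forall U : set (point_list (cube R d)), measurable U ->
      pushforward (ppm mu d) (restrict_list A) U =
      ppm_on (mu%:num * (nng_prob (uniform_cube R d) A)%:num)%:nng
        (cond_prob mA p_gt0) U)
  /\
  (uniform_cube R d A = 0%E ->
    {ae ppm mu d, forall s, restrict_list A s = empty_list}).
Proof.
split=> [p_gt0 U mU|]; first exact: ppm_on_restrict.
exact: ppm_on_restrict_null.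
Qed.
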